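(* Let $d=1$, $\gamma=1$, and let $c\in\mathbb{Z}$ with $|c|\le 2$ be the dimensionless velocity. For every $\Delta\ell>0$, the flattened weights of the adaptive multiresolution stream phase satisfy the recurrence relation $$\begin{pmatrix}C_{\Delta\ell,-2}\\C_{\Delta\ell,-1}\\C_{\Delta\ell,0}\\C_{\Delta\ell,1}\\C_{\Delta\ell,2}\end{pmatrix}=\begin{pmatrix}0&-1/8&0&0&0\\2&9/8&0&-1/8&0\\0&9/8&2&9/8&0\\0&-1/8&0&9/8&2\\0&0&0&-1/8&0\end{pmatrix}\begin{pmatrix}C_{\Delta\ell-1,-2}\\C_{\Delta\ell-1,-1}\\C_{\Delta\ell-1,0}\\C_{\Delta\ell-1,1}\\C_{\Delta\ell-1,2}\end{pmatrix},$$ where the initialization is $C_{0,-c}=1$, $C_{0,0}=-1$ and the remaining terms zero if $c\ne0$ (and all terms zero if $c=0$). Therefore, the adaptive stream phase matches that of the reference scheme up to order $s=3$, that is, for every $\Delta\ell\ge 0$ and every velocity $c\in\mathbb{Z}$ with $|c|\le 2$, $$\sum_{m=-2}^{2}C_{\Delta\ell,m}=0,\quad \sum_{m=-2}^{2}m\,C_{\Delta\ell,m}=-c,\quad \sum_{m=-2}^{2}m^2C_{\Delta\ell,m}=\frac{c^2}{2^{\Delta\ell}},\quad \sum_{m=-2}^{2}m^3C_{\Delta\ell,m}=-\frac{c^3}{4^{\Delta\ell}} .$$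
   Context: Setting ($d=1$). Cells of level $\ell$ are indexed by $k\in\mathbb{Z}$; $\overline{L}$ is the finest level and $\Delta\ell=\overline{L}-\ell\ge 0$. The cell $(\ell,k)$ has the two children $(\ell+1,2k)$ and $(\ell+1,2k+1)$. A distribution function moves with dimensionless velocity $c\in\mathbb{Z}$, and one assumes $|c|\le 2$ for all velocities. Let $(f_k)_{k\in\mathbb{Z}}$ be the (post-collision) cell averages at level $\ell$ (the mesh is uniform at level $\ell$). Prediction and reconstruction for $\gamma=1$: the predicted value on a child is $$\hat g_{2k+\delta}=g_k-\frac{(-1)^\delta}{8}\,(g_{k+1}-g_{k-1}),\qquad \delta=0,1.$$ The reconstruction $(\hat{\hat f}_{\overline k})_{\overline k\in\mathbb{Z}}$ on the finest level $\overline{L}$ is obtained from $(f_k)_k$ by applying the prediction operator recursively $\Delta\ell$ times (if $\Delta\ell=0$ it is $f$ itself). Multiresolution stream phase: with $\mathcal{B}_k=\{2^{\Delta\ell}k+\delta:\ \delta=0,\dots,2^{\Delta\ell}-1\}$, $\mathcal{E}_k=(\mathcal{B}_k-c)\setminus\mathcal{B}_k$, $\mathcal{A}_k=\mathcal{B}_k\setminus(\mathcal{B}_k-c)$, the updated average on cell $(\ell,k)$ is $$f_k+\frac{1}{2^{\Delta\ell}}\Big(\sum_{\overline k\in\mathcal{E}_k}\hat{\hat f}_{\overline k}-\sum_{\overline k\in\mathcal{A}_k}\hat{\hat f}_{\overline k}\Big).$$ Flattened weights: the real numbers $(C_{\Delta\ell,m})_{m=-2}^{2}$ (depending on $c$)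 such that, for all data $(f_k)_k$ and all $k$, $$\sum_{\overline k\in\mathcal{E}_k}\hat{\hat f}_{\overline k}-\sum_{\overline k\in\mathcal{A}_k}\hat{\hat f}_{\overline k}=\sum_{m=-2}^{2}C_{\Delta\ell,m}\,f_{k+m}.$$ Match: the adaptive stream phase matches that of the reference scheme at order $s\ge 1$ if $\sum_{m=-2}^{2}C_{\Delta\ell,m}=0$ and $\sum_{m=-2}^{2}m^pC_{\Delta\ell,m}=\dfrac{(-c)^p}{2^{\Delta\ell(p-1)}}$ for $p=1,\dots,s$, for every $\Delta\ell\ge 0$ and every velocity $c$ of the scheme. *)

(* Defs.v *)
From HB Require Import structures.
From mathcomp Require Import all_boot all_order all_algebra.
From mathcomp Require Import finmap reals.
Set Implicit Arguments.
Unset Strict Implicit.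
Unset Printing Implicit Defensive.
Import Order.TTheory GRing.Theory Num.Theory.
Local Open Scope ring_scope.

Section Reconstruction.
Variable R : realType.

(* Value on the child j = 2 k + delta, where k and delta are recovered by
   Euclidean division (quotient rounded down, remainder in {0, 1}). *)
Definition predict (g : int -> R) (j : int) : R :=
  let k := (j %/ 2)%Z in let delta := `|(j %% 2)%Z|%N in
  g k - (-1) ^+ delta / 8 * (g (k + 1) - g (k - 1)).

Lemma predict_child (g : int -> R) (k : int) (delta : nat) : (delta < 2)%N ->
  predict g (2 * k + delta%:Z)
  = g k - (-1) ^+ delta / 8 * (g (k + 1) - g (k - 1)).
Proof.
move=> lt2; rewrite /predict mulrC divzMDl // modzMDl.
by rewrite divz_small ?modz_small ?addr0.
Qed.

Definition reconstruct (dl : nat) (f : int -> R) : int -> R :=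
  iter dl predict f.

End Reconstruction.

Definition cells_B (dl : nat) (k : int) : {fset int} :=
  [fset (2 ^+ dl * k + delta%:Z)%R | delta in iota 0 (2 ^ dl)]%fset.

Definition shifted_B (c : int) (dl : nat) (k : int) : {fset int} :=
  [fset (j - c)%R | j in cells_B dl k]%fset.

Definition cells_E (c : int) (dl : nat) (k : int) : {fset int} :=
  (shifted_B c dl k `\` cells_B dl k)%fset.

Definition cells_A (c : int) (dl : nat) (k : int) : {fset int} :=
  (cells_B dl k `\` shifted_B c dl k)%fset.

(* Families indexed by m = -2, ..., 2 are column vectors of size 5;
   row i carries the index m = i - 2. *)
Definition offset (i : 'I_5) : int := i%:Z - 2.

Section Weights.
Variable R : realType.

Definition stream_flux (c : int) (dl : nat) (f : int -> R) (k : int) : R :=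
  \sum_(j <- cells_E c dl k) reconstruct dl f j
  - \sum_(j <- cells_A c dl k) reconstruct dl f j.

Definition flattened_weights (c : int) (dl : nat) (C : 'cV[R]_5) : Prop :=
  forall (f : int -> R) (k : int),
    stream_flux c dl f k = \sum_(i < 5) C i 0 * f (k + offset i).

Definition initial_weights (c : int) : 'cV[R]_5 :=
  \col_i (if c == 0 then 0
          else if offset i == - c then 1
          else if offset i == 0 then -1 else 0).

Definition recurrence_matrix : 'M[R]_5 :=
  \matrix_(i, j) nth 0 (nth [::]
    [:: [:: 0; - (1 / 8);     0; 0;         0];
        [:: 2;     9 / 8;     0; - (1 / 8); 0];
        [:: 0;     9 / 8;     2; 9 / 8;     0];
        [:: 0;     - (1 / 8); 0; 9 / 8;     2];
        [:: 0;     0;         0; - (1 / 8); 0]] i) j.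

Definition moment (p : nat) (C : 'cV[R]_5) : R :=
  \sum_(i < 5) (offset i)%:~R ^+ p * C i 0.

(* V is the set of velocities of the scheme and C c dl the weights attached
   to the velocity c at level distance dl. *)
Definition matches_at_order (V : pred int) (C : int -> nat -> 'cV[R]_5)
    (s : nat) : Prop :=
  forall (c : int) (dl : nat), V c ->
    \sum_(i < 5) C c dl i 0 = 0 /\
    forall p : nat, (1 <= p <= s)%N ->
      moment p (C c dl) = (- c)%:~R ^+ p / 2 ^+ (dl * (p - 1)).

End Weights.

(* Main.v *)
Require Import Defs.
From HB Require Import structures.
From mathcomp Require Import all_boot all_order all_algebra.
From mathcomp Require Import finmap reals.
From mathcomp Require Import zify ring.
Set Implicit Arguments.
Unset Strict Implicit.
Unset Printing Implicit Defensive.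
Import Order.TTheory GRing.Theory Num.Theory.
Local Open Scope ring_scope.

(** Cells common to the block and its translate cancel, so the flux
    through the boundary of a cell is the sum of the reconstruction over the
    translated block minus its sum over the block: [stream_flux_shift].  In this
    form nothing depends on how [c] compares with the size of the block, and the
    flux is additive over a partition of the block.  Since the block of a cell
    at distance [dl + 1] is the union of the blocks of its two children at
    distance [dl], and since reconstructing [f] through [dl + 1] levels is
    reconstructing [predict f] through [dl] levels, the flux of [f] through
    cell [k] is the sum of the fluxes of [predict f] through cells [2 k] and
    [2 k + 1]: [stream_flux_children].

    If the latter are given by weights [C], the former is a combination of the
    pair sums [predict f (2 k + m) + predict f (2 k + 1 + m)] with coefficients
    [C_m].  For even [m] this pair consists of the two children of one cell, and
    conservation gives twice the parent; for odd [m] it straddles two cells, and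
    gives the stencil (-1/8, 9/8, 9/8, -1/8).  For [|m| <= 2] all these stencils
    stay within [k - 2 .. k + 2]; their coefficients are the columns of the
    matrix: [predict_pair_sums].  With the direct computation at [dl = 0] this
    gives existence and the recurrence; evaluating on indicator data gives
    uniqueness.

    For the moments, the row vector (m^p)_m is a left eigenvector of the matrix
    for the eigenvalue 2^(1-p) when [p <= 3]: [moment_recurrence].  The initial
    moments are those of a unit mass moved from 0 to [-c], that is 0 for
    [p = 0] and (-c)^p otherwise. *)

(** * Sums over blocks of cells *)

Section Blocks.
Variable R : zmodType.

(** Both sides lose the sum over the intersection. *)
Lemma sum_fsetD_antisym (T : choiceType) (A B : {fset T}) (F : T -> R) :
  \sum_(j <- (A `\` B)%fset) F j - \sum_(j <- (B `\` A)%fset) F j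
  = \sum_(j <- A) F j - \sum_(j <- B) F j.
Proof.
rewrite (big_fsetID _ (fun j => j \in B) A) (big_fsetID _ (fun j => j \in A) B).
have -> : [fset x in A | x \in B]%fset = (A `&` B)%fset.
  by apply/fsetP => x; rewrite !inE.
have -> : [fset x in B | x \in A]%fset = (A `&` B)%fset.
  by apply/fsetP => x; rewrite !inE andbC.
have -> : [fset x in A | x \notin B]%fset = (A `\` B)%fset.
  by apply/fsetP => x; rewrite !inE andbC.
have -> : [fset x in B | x \notin A]%fset = (B `\` A)%fset.
  by apply/fsetP => x; rewrite !inE andbC.
by rewrite /= opprD addrACA subrr add0r.
Qed.

Lemma sum_cells_B (dl : nat) (k : int) (F : int -> R) :
  \sum_(j <- cells_B dl k) F j
  = \sum_(delta < 2 ^ dl) F (2 ^+ dl * k + delta%:Z).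
Proof.
rewrite /cells_B big_imfset /=; last by move=> x y _ _ /addrI [].
rewrite undup_id ?iota_uniq //.
rewrite -(big_mkord predT (fun d : nat => F (2 ^+ dl * k + d%:Z))).
by rewrite /index_iota subn0.
Qed.

Lemma sum_shifted_B (c : int) (dl : nat) (k : int) (F : int -> R) :
  \sum_(j <- shifted_B c dl k) F j = \sum_(j <- cells_B dl k) F (j - c).
Proof. by rewrite /shifted_B big_imfset //= => x y _ _ /addIr. Qed.

(** The block of a cell is the union of the blocks of its children. *)
Lemma sum_cells_B_children (dl : nat) (k : int) (F : int -> R) :
  \sum_(j <- cells_B dl.+1 k) F j
  = \sum_(j <- cells_B dl (2 * k)) F j + \sum_(j <- cells_B dl (2 * k + 1)) F j.
Proof.
rewrite !sum_cells_B expnS mul2n -addnn big_split_ord /=.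
congr (_ + _); apply: eq_bigr => i _; congr F.
  by rewrite exprS; ring.
by rewrite exprS PoszD -natz natrX; ring.
Qed.

End Blocks.

(** * Streaming commutes with refinement *)

Section Streaming.
Variable R : realType.
Implicit Types (f : int -> R) (c k : int) (C : 'cV[R]_5).

(** Valid for every [c], including those that carry the block off itself, as
    happens at [dl = 0]. *)
Lemma stream_flux_shift c dl f k :
  stream_flux c dl f k
  = \sum_(j <- cells_B dl k) reconstruct dl f (j - c)
    - \sum_(j <- cells_B dl k) reconstruct dl f j.
Proof. by rewrite /stream_flux sum_fsetD_antisym sum_shifted_B. Qed.

Lemma stream_flux0 c f k : stream_flux c 0 f k = f (k - c) - f k.
Proof.
by rewrite stream_flux_shift !sum_cells_B expn0 !big_ord1 expr0 mul1r addr0.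
Qed.

Lemma stream_flux_children c dl f k :
  stream_flux c dl.+1 f k
  = stream_flux c dl (predict f) (2 * k)
    + stream_flux c dl (predict f) (2 * k + 1).
Proof.
by rewrite !stream_flux_shift !sum_cells_B_children /reconstruct iterSr
  opprD addrACA.
Qed.

(** [F] receives the offset separately from the index, so that the offsets
    become numerals while the entries of a vector stay symbolic. *)
Lemma sum_offsets (F : 'I_5 -> int -> R) :
  \sum_(i < 5) F i (offset i)
  = F (inord 0) (-2) + F (inord 1) (-1) + F (inord 2) 0 + F (inord 3) 1
    + F (inord 4) 2.
Proof.
rewrite !big_ord_recr big_ord0 /= add0r.
by congr (_ + _ + _ + _ + _); congr F; apply/val_inj; rewrite /= ?inordK.
Qed.

(** The right-hand side lists the columns of the matrix: it is the action of the
    transpose on the test function [phi]. *)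
Lemma recurrence_dual C (phi : int -> R) :
  \sum_(i < 5) (recurrence_matrix R *m C) i 0 * phi (offset i)
  = C (inord 0) 0 * (2 * phi (-1))
    + C (inord 1) 0
        * (9 / 8 * (phi (-1) + phi 0) - 1 / 8 * (phi (-2) + phi 1))
    + C (inord 2) 0 * (2 * phi 0)
    + C (inord 3) 0 * (9 / 8 * (phi 0 + phi 1) - 1 / 8 * (phi (-1) + phi 2))
    + C (inord 4) 0 * (2 * phi 1).
Proof.
rewrite (sum_offsets (fun i m => (recurrence_matrix R *m C) i 0 * phi m)) !mxE.
rewrite !(sum_offsets (fun j _ => recurrence_matrix R _ j * C j 0)).
by rewrite !mxE !inordK //=; field.
Qed.

(** Conservation: the corrections of the two children are opposite. *)
Lemma predict_siblings f k :
  predict f (2 * k) + predict f (2 * k + 1) = 2 * f k.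
Proof.
rewrite (predict_child f k (delta := 1)) // -[2 * k]addr0.
by rewrite (predict_child f k (delta := 0)) // expr0 expr1; field.
Qed.

Lemma predict_neighbours f k :
  predict f (2 * k + 1) + predict f (2 * (k + 1))
  = 9 / 8 * (f k + f (k + 1)) - 1 / 8 * (f (k - 1) + f (k + 2)).
Proof.
rewrite (predict_child f k (delta := 1)) // -[2 * (k + 1)]addr0.
rewrite (predict_child f _ (delta := 0)) // expr0 expr1 addrK.
have -> : k + 1 + 1 = k + 2 by ring.
by field.
Qed.

(** The parity of [m] decides whether the two cells of a pair are siblings or
    neighbours with distinct parents; each case gives one column of the
    matrix. *)
Lemma predict_pair_sums C f k :
  \sum_(i < 5) C i 0
      * (predict f (2 * k + offset i) + predict f (2 * k + 1 + offset i))
  = \sum_(i < 5) (recurrence_matrix R *m C) i 0 * f (k + offset i).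
Proof.
rewrite (sum_offsets (fun i m => C i 0
  * (predict f (2 * k + m) + predict f (2 * k + 1 + m)))).
rewrite (recurrence_dual C (fun m => f (k + m))) !addr0.
congr (_ * _ + _ * _ + _ * _ + _ * _ + _ * _).
- by rewrite -predict_siblings; congr (predict f _ + predict f _); ring.
- have := predict_neighbours f (k - 1); rewrite subrK.
  have -> : k - 1 - 1 = k - 2 by ring.
  have -> : k - 1 + 2 = k + 1 by ring.
  by move=> <-; congr (predict f _ + predict f _); ring.
- exact: predict_siblings.
- by rewrite -predict_neighbours; congr (predict f _ + predict f _); ring.
- by rewrite -predict_siblings; congr (predict f _ + predict f _); ring.
Qed.

(** * The flattened weights *)

Lemma flattened_weights0 c : `|c| <= 2 ->
  flattened_weights c 0 (initial_weights R c).
Proof.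
move=> c_le2 f k; rewrite stream_flux0.
under eq_bigr do rewrite mxE.
rewrite (sum_offsets (fun _ m => (if c == 0 then 0 else if m == - c then 1
  else if m == 0 then -1 else 0) * f (k + m))).
have [->|[->|[->|[->|->]]]] : c = -2 \/ c = -1 \/ c = 0 \/ c = 1 \/ c = 2 by lia.
all: by rewrite /= ?addr0 ?subr0 ?opprK; ring.
Qed.

Lemma flattened_weightsS c dl C : flattened_weights c dl C ->
  flattened_weights c dl.+1 (recurrence_matrix R *m C).
Proof.
move=> hC f k; rewrite stream_flux_children !hC.
rewrite -predict_pair_sums -big_split /=.
by apply: eq_bigr => i _; rewrite -mulrDr.
Qed.

Lemma flattened_weights_exist c dl : `|c| <= 2 ->
  exists C, flattened_weights c dl C.
Proof.
move=> c_le2; elim: dl => [|dl [C hC]].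
  by exists (initial_weights R c); apply: flattened_weights0.
by exists (recurrence_matrix R *m C); apply: flattened_weightsS.
Qed.

(** The weight of index [i] is the flux through cell 0 of the indicator of the
    cell at [offset i]. *)
Lemma flattened_weights_unique c dl C D :
  flattened_weights c dl C -> flattened_weights c dl D -> C = D.
Proof.
move=> hC hD; apply/matrixP => i j; rewrite (ord1 j).
have weightE (E : 'cV[R]_5) : flattened_weights c dl E ->
    stream_flux c dl (fun m => (m == offset i)%:R) 0 = E i 0.
  move=> ->; rewrite (bigD1 i) //= add0r eqxx mulr1 big1 ?addr0 // => l neq_li.
  have /negPf -> : 0 + offset l != offset i.
    apply: contraNneq neq_li => eq_li; apply/eqP/val_inj.
    by move: eq_li; rewrite /offset add0r /= => /addIr [].
  by rewrite mulr0.
by rewrite -(weightE C hC) (weightE D hD).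
Qed.

(** * Moments *)

(** Left eigenvectors: the column of index [m], tested against [m^p], gives
    [2^(1-p) m^p].  This fails from [p = 4] on. *)
Lemma moment_recurrence p C : (p <= 3)%N ->
  moment p (recurrence_matrix R *m C) = 2 / 2 ^+ p * moment p C.
Proof.
move=> p_le3; rewrite /moment.
under eq_bigr do rewrite mulrC.
rewrite (recurrence_dual C (fun m => m%:~R ^+ p)).
rewrite (sum_offsets (fun i m => m%:~R ^+ p * C i 0)).
by move: p p_le3 => [|[|[|[|]]]] // _; field.
Qed.

(** At distance 0 the flux of [m^p] through cell 0 is (-c)^p - 0^p, and each
    level contributes one eigenvalue.  For [p = 0] the initial moment is 0. *)
Lemma moment_flattened_weights c dl C p : `|c| <= 2 -> (p <= 3)%N ->
  flattened_weights c dl C ->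
  moment p C = (2 / 2 ^+ p) ^+ dl * ((- c)%:~R ^+ p - 0 ^+ p).
Proof.
move=> c_le2 p_le3; elim: dl C => [|dl IHdl] C hC.
  have := hC (fun m => m%:~R ^+ p) 0; rewrite stream_flux0.
  rewrite expr0 mul1r sub0r => ->.
  by apply: eq_bigr => i _; rewrite add0r mulrC.
have [C' hC'] := flattened_weights_exist dl c_le2.
rewrite (flattened_weights_unique hC (flattened_weightsS hC')).
by rewrite moment_recurrence // IHdl // exprS mulrA.
Qed.

End Streaming.

Theorem proposition5p4 (R : realType) :
  (forall (c : int) (dl : nat), `|c| <= 2 ->
     exists! C : 'cV[R]_5, flattened_weights c dl C)
  /\
  (forall C : int -> nat -> 'cV[R]_5,
     (forall (c : int) (dl : nat), `|c| <= 2 ->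
        flattened_weights c dl (C c dl)) ->
     (forall c : int, `|c| <= 2 ->
        C c 0%N = initial_weights R c /\
        forall dl : nat, (0 < dl)%N ->
          C c dl = recurrence_matrix R *m C c (dl - 1)%N)
     /\ matches_at_order (fun c : int => `|c| <= 2) C 3
     /\ (forall (c : int) (dl : nat), `|c| <= 2 ->
           [/\ \sum_(i < 5) C c dl i 0 = 0,
               \sum_(i < 5) (offset i)%:~R * C c dl i 0 = - c%:~R,
               \sum_(i < 5) (offset i)%:~R ^+ 2 * C c dl i 0
                 = c%:~R ^+ 2 / 2 ^+ dl
             & \sum_(i < 5) (offset i)%:~R ^+ 3 * C c dl i 0
                 = - (c%:~R ^+ 3 / 4 ^+ dl)])).
Proof.
split=> [c dl c_le2|C hC].
  have [C hC] := flattened_weights_exist R dl c_le2.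
  by exists C; split=> // D; apply: flattened_weights_unique hC.
have momentE (c : int) dl p : `|c| <= 2 -> (p <= 3)%N -> moment p (C c dl)
    = (2 / 2 ^+ p) ^+ dl * ((- c)%:~R ^+ p - 0 ^+ p).
  by move=> c_le2 p_le3; apply: moment_flattened_weights => //; apply: hC.
have sum0 (c : int) dl : `|c| <= 2 -> \sum_(i < 5) C c dl i 0 = 0.
  move=> c_le2; have := momentE c dl 0%N c_le2 isT.
  rewrite !expr0 subrr mulr0 => m0; rewrite -[RHS]m0.
  by apply: eq_bigr => i _; rewrite expr0 mul1r.
have matchC : matches_at_order (fun c : int => `|c| <= 2) C 3.
  move=> c dl c_le2; split=> [|[//|p] p_le2]; first exact: sum0.
  have eigenvalueE : 2 / 2 ^+ p.+1 = (2 ^+ p)^-1 :> R.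
    by rewrite exprS invfM mulrA divff ?pnatr_eq0 ?mul1r.
  rewrite momentE // eigenvalueE expr0n subr0 mulrC subn1 /=.
  by rewrite [(dl * p)%N]mulnC exprM exprVn.
split; last split=> //.
  move=> c c_le2; split.
    exact: flattened_weights_unique (hC c 0%N c_le2) (flattened_weights0 c_le2).
  case=> // dl _; rewrite subn1.
  apply: flattened_weights_unique (hC c dl.+1 c_le2) _.
  by apply: flattened_weightsS; apply: hC.
move=> c dl c_le2; have [_ matchc] := matchC c dl c_le2.
split.
- exact: sum0.
- have := matchc 1%N isT; rewrite muln0 expr0 divr1 expr1 rmorphN /moment => <-.
  by apply: eq_bigr => i _; rewrite expr1.
- by have := matchc 2%N isT; rewrite muln1 rmorphN sqrrN.
have := matchc 3%N isT; rewrite mulnC exprM rmorphN /moment -natrX => ->.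
by rewrite exprNn -signr_odd expr1 mulN1r mulNr.
Qed.
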